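(* There exist constants $c>0$ and $n_0$ such that for every generic set $P$ of $n\ge n_0$ points in the plane there exists a subset $Q\subseteq P$ with $\operatorname{cr}(Q)\ge c\log^2 n$. (That is, $\operatorname{cr}(Q)\in\Omega(\log^2 n)$.)
   Context: A finite planar point set is in general position if no three of its points are collinear. It is generic if it is in general position and every subset of it has a unique (Euclidean) minimum spanning tree (MST); for a generic set $X$, $T_X$ denotes the MST of $X$, drawn with straight-line edges. For disjoint point sets $R,B$ with $R\cup B$ generic, $\operatorname{cr}(R,B)$ denotes the number of crossings between the edges of $T_R$ and the edges of $T_B$. For a generic point set $Q$, $\operatorname{cr}(Q)=\max \operatorname{cr}(R,B)$, the maximum over all partitions $Q=R\cup B$ into two disjoint sets. Logarithms are base $2$. *)

(* Defs.v *)
From HB Require Import structures.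
From mathcomp Require Import all_boot all_order all_algebra.
From mathcomp Require Import finmap.
From mathcomp Require Import boolp reals exp.
Set Implicit Arguments. Unset Strict Implicit. Unset Printing Implicit Defensive.
Import Order.TTheory GRing.Theory Num.Theory.
Local Open Scope fset_scope.
Local Open Scope ring_scope.

Section Geometry.
Variable R : realType.
Definition pt := (R * R)%type.

Definition collinear (a b c : pt) : bool :=
  ((fst b) - (fst a)) * ((snd c) - (snd a)) - ((snd b) - (snd a)) * ((fst c) - (fst a)) == 0.

Definition general_position (X : {fset pt}) : Prop :=
  forall a b c, a \in X -> b \in X -> c \in X ->
    a != b -> b != c -> a != c -> ~~ collinear a b c.

Definition dist (a b : pt) : R := Num.sqrt (((fst a) - (fst b)) ^+ 2 + ((snd a) - (snd b)) ^+ 2).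

Definition elen (e : {fset pt}) : R :=
  if enum_fset e is [:: a; b] then dist a b else 0.

Definition adj (E : {fset {fset pt}}) (x y : pt) : bool := [fset x; y] \in E.

Definition graph_on (X : {fset pt}) (E : {fset {fset pt}}) : Prop :=
  forall e, e \in E -> #|` e| = 2%N /\ fsubset e X.

Definition connectedG (X : {fset pt}) (E : {fset {fset pt}}) : Prop :=
  forall a b, a \in X -> b \in X ->
    exists s : seq pt, path (adj E) a s /\ last a s = b.

Definition acyclicG (E : {fset {fset pt}}) : Prop :=
  ~ exists s : seq pt, [/\ uniq s, (3 <= size s)%N & cycle (adj E) s].

Definition spanning_tree (X : {fset pt}) (T : {fset {fset pt}}) : Prop :=
  [/\ graph_on X T, connectedG X T & acyclicG T].

Definition weight (E : {fset {fset pt}}) : R := \sum_(e <- E) elen e.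

Definition is_MST (X : {fset pt}) (T : {fset {fset pt}}) : Prop :=
  spanning_tree X T /\ forall T', spanning_tree X T' -> weight T <= weight T'.

Definition generic (X : {fset pt}) : Prop :=
  general_position X /\
  forall Y, fsubset Y X ->
    exists T, is_MST Y T /\ forall T', is_MST Y T' -> T' = T.

(* T_X : the (for generic X unique) MST of X *)
Definition MST_of (X : {fset pt}) : {fset {fset pt}} :=
  match pselect (exists T, is_MST X T) with
  | left h => projT1 (cid h)
  | right _ => fset0
  end.

Definition on_seg (p a b : pt) : Prop :=
  exists t : R, [/\ 0 <= t, t <= 1, (fst p) = (fst a) + t * ((fst b) - (fst a))
                                  & (snd p) = (snd a) + t * ((snd b) - (snd a))].

Definition edges_cross (e f : {fset pt}) : Prop :=
  exists a b c d p, [/\ e = [fset a; b], f = [fset c; d],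
                        on_seg p a b & on_seg p c d].

Definition ncross (E F : {fset {fset pt}}) : nat :=
  \sum_(e <- E) \sum_(f <- F) (`[< edges_cross e f >] : nat).

Definition crRB (Rs Bs : {fset pt}) : nat := ncross (MST_of Rs) (MST_of Bs).

Definition cr (Q : {fset pt}) : nat :=
  \max_(Rs <- fpowerset Q) crRB Rs (Q `\` Rs).

Definition log2 (x : R) : R := ln x / ln 2.
End Geometry.

(* Main.v *)
(* In fact cr(Q) is at least a constant times sqrt n.  Any five points contain
   two disjoint pairs a, b and c, d whose segments cross; colour a, b red and
   c, d blue.  Such a crossing counts as soon as ab and cd are MST edges of
   their colour classes, which the cut property guarantees if the five-point
   clusters are suitably placed.  Let rho p be the radius, in the sup norm, of
   the smallest ball centred at p with five points, and let p be in conflict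
   with q when |p - q| <= 10 max (rho p, rho q).
   - If every p has few conflicts with points q such that rho q >= rho p, a
     greedy choice gives many pairwise conflict-free points; their clusters are
     far apart compared with their diameters.
   - If some p has many such conflicts, packing forces the radii rho q to spread
     over many scales, so there are many points whose distances to p grow
     geometrically.  Those lying in one octant around p, taken in this order,
     form a path that is the MST, also after restriction to any subset, and
     blocks of five consecutive points serve as clusters. *)

Require Import Defs.
From HB Require Import structures.
From mathcomp Require Import all_boot all_order all_algebra.
From mathcomp Require Import finmap.
From mathcomp Require Import boolp reals exp.
From mathcomp Require Import ring lra zify.
Set Implicit Arguments.
Unset Strict Implicit.
Unset Printing Implicit Defensive.
Import Order.TTheory GRing.Theory Num.Theory.
Local Open Scope fset_scope.
Local Open Scope ring_scope.

(** * Spanning trees and the cut property *)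

Section SpanningTrees.
Variable R : realType.
Implicit Types (X S : {fset pt R}) (E T : {fset {fset pt R}}) (a b x y : pt R).

Definition joined E a b : Prop := exists2 s, path (adj E) a s & last a s = b.

Lemma adjC E : symmetric (adj E).
Proof. by move=> x y; rewrite /adj fsetUC. Qed.

Lemma joined_refl E a : joined E a a.
Proof. by exists [::]. Qed.

Lemma joined_adj E a b : adj E a b -> joined E a b.
Proof. by move=> ab; exists [:: b] => //=; rewrite ab. Qed.

Lemma joined_sym E a b : joined E a b -> joined E b a.
Proof.
case=> s ps ls; exists (rev (belast a s)).
  by rewrite -ls rev_path; apply: sub_path ps => x y; rewrite /= adjC.
by case: s ps ls => [|c s] //= _ _; rewrite rev_cons last_rcons.
Qed.

Lemma joined_trans E b a c : joined E a b -> joined E b c -> joined E a c.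
Proof.
case=> s ps ls [t pt lt]; exists (s ++ t); last by rewrite last_cat ls.
by rewrite cat_path ps ls.
Qed.

Lemma joined_path E F a s :
  (forall x y, adj E x y -> joined F x y) -> path (adj E) a s ->
  joined F a (last a s).
Proof.
move=> EF; elim: s a => [|b s IHs] a /=; first by move=> _; exact: joined_refl.
by case/andP=> /EF ab /IHs; exact: joined_trans.
Qed.

Lemma fset2_eq (K : choiceType) (a b c d : K) :
  [fset a; b] = [fset c; d] -> a = c /\ b = d \/ a = d /\ b = c.
Proof.
move=> e.
have : a \in [fset c; d] by rewrite -e !inE eqxx.
have : b \in [fset c; d] by rewrite -e !inE eqxx orbT.
have : c \in [fset a; b] by rewrite e !inE eqxx.
have : d \in [fset a; b] by rewrite e !inE eqxx orbT.
rewrite !inE => /orP[]/eqP -> /orP[]/eqP -> /orP[]/eqP ? /orP[]/eqP ?; subst; by [left|right].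
Qed.

Lemma connectedG_del X E a b :
  connectedG X E -> joined (E `\ [fset a; b]) a b ->
  connectedG X (E `\ [fset a; b]).
Proof.
move=> cE jab x y /cE /[apply] -[s [ps <-]].
suff [t pt lt] : joined (E `\ [fset a; b]) x (last x s) by exists t.
apply: (joined_path _ ps) => u v uv.
have [/fset2_eq[[-> ->]|[-> ->]]|ne] := eqVneq [fset u; v] [fset a; b].
- exact: jab.
- exact: joined_sym.
by apply: joined_adj; rewrite /adj in_fsetD1 ne.
Qed.

(** The rest of the cycle is a detour from [y] back to [x]. As [s] is nonempty and the vertices are
    distinct, no step of the detour is the edge [xy] itself. *)
Lemma cycle_joined E x y s :
  uniq [:: x, y & s] -> s != [::] -> cycle (adj E) [:: x, y & s] ->
  joined (E `\ [fset x; y]) x y.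
Proof.
case: s => [|z s] //; rewrite /= !rcons_path => /and3P[xs ys us] _.
case/and3P=> xy yz /andP[ps lx]; apply: joined_sym.
have sub (e : {fset pt R}) : e \in E -> e != [fset x; y] -> e \in E `\ [fset x; y].
  by move=> eE ne; rewrite in_fsetD1 ne.
have nxy a b : a != y -> b != y -> [fset a; b] != [fset x; y].
  by move=> ay yb; apply/eqP=> /fset2_eq[[]|[]] ? ?; subst; rewrite eqxx in ay yb.
have {}ys : y \notin rcons (z :: s) x.
  rewrite mem_rcons in_cons negb_or ys andbT eq_sym.
  by move: xs; rewrite in_cons negb_or => /andP[].
apply: (joined_trans (b := z)).
  apply: joined_adj; apply: sub => //; apply/eqP=> /fset2_eq[[yx zy]|[_ zx]].
    by move: ys; rewrite yx mem_rcons in_cons eqxx.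
  by move: xs; rewrite zx !inE eqxx orbT.
exists (rcons s x); last by rewrite last_rcons.
have : path (adj E) z (rcons s x) by rewrite rcons_path ps.
move: ys; rewrite rcons_cons in_cons negb_or eq_sym => /andP[].
elim: (rcons s x) z {yz lx us xs ps} => //= b t IHt z zy; rewrite in_cons negb_or eq_sym.
case/andP=> yb yt /andP[zb pt]; rewrite IHt // andbT.
by apply: sub => //; exact: nxy.
Qed.

Lemma graph_on_del X E e : graph_on X E -> graph_on X (E `\ e).
Proof. by move=> gE f; rewrite in_fsetD1 => /andP[_ /gE]. Qed.

(** [elen] reads an enumeration of the pair in an unspecified order; the symmetry of [dist] makes
    both orders agree. *)
Lemma elen_pair a b : a != b -> elen [fset a; b] = dist a b.
Proof.
move=> ab; rewrite /elen.
have: perm_eq (enum_fset [fset a; b]) [:: a; b].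
  apply: uniq_perm => [||x]; first exact: fset_uniq.
    by rewrite /= inE ab.
  by rewrite !inE.
move=> pab; have := perm_size pab; have := perm_mem pab.
case: (enum_fset _) pab => [|c [|d [|? ?]]] //= pab mem_cd _.
have dC : dist b a = dist a b.
  by rewrite /dist; congr Num.sqrt; ring.
have := perm_uniq pab; rewrite /= !inE andbT ab => cd.
have := mem_cd a; have := mem_cd b; rewrite !inE !eqxx orbT.
case/orP=> /eqP ? /orP[]/eqP ?; subst => //.
by rewrite eqxx in ab.
by rewrite eqxx in ab.
Qed.

Lemma elen_ge0 (e : {fset pt R}) : 0 <= elen e.
Proof. by rewrite /elen; case: (enum_fset e) => [|? [|? []]] //; exact: sqrtr_ge0. Qed.

Lemma weightD1 E e : e \in E -> weight E = elen e + weight (E `\ e).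
Proof.
move=> eE; rewrite /weight.
by rewrite (big_fsetD1 e eE).
Qed.

Lemma weightU1 E e : e \notin E -> weight (e |` E) = elen e + weight E.
Proof.
move=> eE; rewrite (@weightD1 _ e) ?fset1U1 //.
by rewrite fsetU1K.
Qed.

(** As long as a cycle remains, delete one of its edges: connectivity survives, and the weight
    cannot grow because lengths are nonnegative. *)
Lemma connected_spanning_tree X E :
  graph_on X E -> connectedG X E ->
  exists2 T, spanning_tree X T & weight T <= weight E.
Proof.
have [n] := ubnP #|` E|; elim: n E => // n IHn E lt_n gE cE.
have [acE|] := pselect (acyclicG E); first by exists E.
case/contrapT=> -[|x [|y s]] [us ss cs] //.
have jxy : joined (E `\ [fset x; y]) x y by apply: cycle_joined us _ cs; case: s ss.
have xyE : [fset x; y] \in E by case/andP: cs.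
have [|||T sT wT] := IHn (E `\ [fset x; y]).
- by rewrite (cardfsD1 [fset x; y]) xyE in lt_n.
- exact: graph_on_del.
- exact: connectedG_del.
by exists T => //; rewrite (le_trans wT) // (weightD1 xyE) lerDr elen_ge0.
Qed.

Lemma path_leaves (S : pred (pt R)) e a s : path e a s -> S a != S (last a s) ->
  exists s1 x y s2, a :: s = s1 ++ [:: x, y & s2] /\ S x != S y.
Proof.
elim: s a => [|b s IHs] a /=; first by rewrite eqxx.
case/andP=> ab ps Sab; have [Seq|ne] := eqVneq (S a) (S b); last first.
  by exists [::], a, b, s.
have [|s1 [x [y [s2 [-> Sxy]]]]] := IHs _ ps; first by rewrite -Seq.
by exists (a :: s1), x, y, s2.
Qed.

(** Exchange argument. If [uv] were missing, adding it to [T] would close a cycle that crosses the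
    cut [S] at a second, strictly longer edge [xy]. Deleting [xy] leaves a connected graph lighter
    than [T], and this graph contains a spanning tree. *)
Lemma MST_cut X T (S : pred (pt R)) u v :
  is_MST X T -> u \in X -> v \in X -> S u != S v ->
  (forall x y, x \in X -> y \in X -> S x != S y ->
     [fset x; y] != [fset u; v] -> dist u v < dist x y) ->
  [fset u; v] \in T.
Proof.
case=> -[gT cT _] minT uX vX Suv ltuv; apply: contraT => uvT.
have neq_uv : u != v by apply: contraNneq Suv => ->.
have [s0 [ps0 ls0]] := cT _ _ uX vX.
case/shortenP: ps0 ls0 => s ps us _ lastv.
(* As [uv] is not in [T], the path has at least two edges, so the cycle closed by [uv] has at least
   three vertices. *)
have s_ne : (2 <= size s)%N.
  case: s ps us lastv => [|w [|w' s]] //=; first by move=> _ _ uv; rewrite uv eqxx in neq_uv.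
  by rewrite andbT => uw _ wv; rewrite /adj wv (negPf uvT) in uw.
pose E := [fset u; v] |` T.
have cyE : cycle (adj E) (u :: s).
  rewrite /= rcons_path lastv {2}/adj fsetUC fset1U1 andbT.
  by apply: sub_path ps => x y; rewrite /adj => xy; rewrite in_fset1U xy orbT.
have [|s1 [x [y [s2 [def_s Sxy]]]]] := path_leaves (S := S) ps; first by rewrite lastv.
(* Rotating the cycle brings [xy] to the front, as [cycle_joined] expects. *)
have rot_s : rot (size s1) (u :: s) = [:: x, y & s2 ++ s1].
  by rewrite def_s rot_size_cat.
have cyxy : cycle (adj E) [:: x, y & s2 ++ s1] by rewrite -rot_s rot_cycle.
have uxy : uniq [:: x, y & s2 ++ s1] by rewrite -rot_s rot_uniq.
have gE : graph_on X E.
  move=> e; rewrite in_fset1U => /orP[/eqP->|/gT//].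
  by rewrite cardfs2 neq_uv; split=> //; apply/fsubsetP=> z; rewrite !inE => /orP[]/eqP->.
have cE : connectedG X E.
  move=> a b aX bX; have [t [pt lt]] := cT _ _ aX bX; exists t; split=> //.
  by apply: sub_path pt => ? ?; rewrite /adj => ab; rewrite in_fset1U ab orbT.
have jxy : joined (E `\ [fset x; y]) x y.
  apply: cycle_joined uxy _ cyxy.
  apply: contraTneq s_ne => s12; move/(congr1 size): rot_s.
  by rewrite s12 size_rot => -[->].
have xyT : [fset x; y] \in T.
  have : all (mem T) [seq [fset p.1; p.2] | p <- zip (u :: s) s].
    elim: (s) (u) ps => //= b t IHt a /andP[ab /IHt]; rewrite -/(adj T a b) ab.
    by case: t {IHt}.
  move/allP; apply; apply/mapP; exists (x, y) => //.
  case: s1 def_s {rot_s cyxy uxy jxy} => [[<- ->]|w s1 [_ ->]]; first by rewrite inE eqxx.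
  have -> : u :: s1 ++ [:: x, y & s2] = (u :: s1) ++ [:: x, y & s2] by [].
  by elim: s1 {1}(u) => [|c s1 IHs1] a /=; rewrite !inE ?eqxx ?orbT //= ?IHs1 ?orbT.
have neq_xy : x != y by apply: contraNneq Sxy => ->.
have xyuv : [fset x; y] != [fset u; v] by apply: contraTneq xyT => ->.
have /= xyX : fsubset [fset x; y] X by case: (gT _ xyT).
have xX : x \in X by apply: (fsubsetP xyX); rewrite !inE eqxx.
have yX : y \in X by apply: (fsubsetP xyX); rewrite !inE eqxx orbT.
have [|T' sT' wT'] := connected_spanning_tree _ (connectedG_del cE jxy).
  exact: graph_on_del.
have := le_trans (minT _ sT') wT'; have := ltuv _ _ xX yX Sxy xyuv.
have: weight E = elen [fset x; y] + weight (E `\ [fset x; y]).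
  by apply: weightD1; rewrite in_fset1U xyT orbT.
rewrite (weightU1 uvT) !elen_pair //; lra.
Qed.

End SpanningTrees.

(** * Crossings inside clusters *)

Section FivePoints.
Variable R : realType.
Implicit Types a b c d : pt R.

Definition orient a b c : R :=
  (b.1 - a.1) * (c.2 - a.2) - (b.2 - a.2) * (c.1 - a.1).

Lemma sign_neqE (x y : R) :
  x != 0 -> y != 0 -> ((0 < x) != (0 < y)) = (x * y < 0).
Proof.
case: (ltgtP 0 x) => // x0 _; case: (ltgtP 0 y) => // y0 _ /=.
- by rewrite ltNge mulr_ge0 // ltW.
- by rewrite pmulr_rlt0.
- by rewrite pmulr_llt0.
- by rewrite ltNge mulr_le0 // ltW.
Qed.

Lemma sign_eqE (x y : R) :
  x != 0 -> y != 0 -> ((0 < x) == (0 < y)) = (- x * y < 0).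
Proof.
move=> x0 y0; rewrite -[LHS]negbK sign_neqE // mulNr oppr_lt0 -leNgt le_eqVlt.
by rewrite eq_sym mulf_eq0 (negPf x0) (negPf y0).
Qed.

(** Orientation against a fixed line is affine along a segment. With end values [x] and [y] it
    vanishes at the parameter [x / (x - y)], and opposite signs put this ratio into [0, 1]. *)
Lemma segments_cross a b c d :
  orient a b c * orient a b d < 0 -> orient c d a * orient c d b < 0 ->
  exists p, on_seg p a b /\ on_seg p c d.
Proof.
have ratio (x y : R) : x * y < 0 -> x - y != 0 /\ 0 <= x / (x - y) <= 1.
  move=> xy; have nz : x - y != 0.
    by apply: contraTneq xy => /subr0_eq ->; rewrite -leNgt -expr2 sqr_ge0.
  split=> //; have [y0|y0] := ltP y 0.
    have x0 : 0 < x by rewrite nmulr_llt0 in xy.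
    by rewrite divr_ge0 /= ?ler_pdivrMr; lra.
  have x0 : x < 0 by case: (ltgtP x 0) xy y0 => //; nra.
  by rewrite -(opprB y x) invrN mulrN -mulNr divr_ge0 /= ?ler_pdivrMr; lra.
move=> /ratio[nz2 /andP[s0 s1]] /ratio[nz1 /andP[t0 t1]].
pose t := orient c d a / (orient c d a - orient c d b).
exists (a.1 + t * (b.1 - a.1), a.2 + t * (b.2 - a.2)); split.
  by exists t.
exists (orient a b c / (orient a b c - orient a b d)); split => //=.
  by rewrite /t /orient in nz1 nz2 *; field; rewrite nz1 nz2.
by rewrite /t /orient in nz1 nz2 *; field; rewrite nz1 nz2.
Qed.

(* The only relation among orientations that is needed: for four points,
   [bcd] - [acd] + [abd] - [abc] = 0 excludes alternating signs. *)
Lemma five_points_cross (p : 'I_5 -> pt R) :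
  (forall i j k, i != j -> j != k -> i != k -> ~~ collinear (p i) (p j) (p k)) ->
  exists i j k l, uniq [:: i; j; k; l] /\
    exists q, on_seg q (p i) (p j) /\ on_seg q (p k) (p l).
Proof.
move=> gp.
pose s i j k := 0 < orient (p i) (p j) (p k).
pose o (n : nat) : 'I_5 := inord n.
have oK (m n : nat) : (m < 5)%N -> (n < 5)%N -> (o m == o n) = (m == n).
  by move=> m5 n5; rewrite -val_eqE /= !inordK.
have onz i j k : i != j -> j != k -> i != k -> orient (p i) (p j) (p k) != 0.
  by move=> ij jk ik; have := gp _ _ _ ij jk ik.
have area i j k l : uniq [:: i; j; k; l] ->
    ~~ [&& s j k l == s i j l, s i k l == s i j k & s j k l != s i k l].
  rewrite /= !inE !negb_or -!andbA => /and4P[ij ik il /and3P[jk jl /andP[kl _]]].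
  have := onz _ _ _ jk kl jl; have := onz _ _ _ ik kl il.
  have := onz _ _ _ ij jl il; have := onz _ _ _ ij jk ik.
  have : orient (p j) (p k) (p l) - orient (p i) (p k) (p l)
       + orient (p i) (p j) (p l) - orient (p i) (p j) (p k) = 0.
    by rewrite /orient; ring.
  rewrite /s; set A := orient _ _ _; set B := orient _ _ _.
  set C := orient _ _ _; set D := orient _ _ _ => h D0 C0 B0 A0.
  by case: (ltgtP 0 A) A0; case: (ltgtP 0 B) B0; case: (ltgtP 0 C) C0;
     case: (ltgtP 0 D) D0 => //=; lra.
(* The three disjuncts are the three ways to split four points into two pairs: ij|kl, ik|jl and
   il|jk. Each says that either pair is separated by the line through the other, written with the
   orientations of increasing triples only. *)
have cross i j k l : uniq [:: i; j; k; l] ->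
    [|| (s i j k != s i j l) && (s i k l != s j k l),
        (s i j k == s i k l) && (s i j l == s j k l) |
        (s i j l != s i k l) && (s i j k != s j k l)] ->
    exists i j k l, uniq [:: i; j; k; l] /\
      exists q, on_seg q (p i) (p j) /\ on_seg q (p k) (p l).
  move=> u; have := u.
  rewrite /= !inE !negb_or -!andbA => /and4P[ij ik il /and3P[jk jl /andP[kl _]]].
  have := onz _ _ _ jk kl jl; have := onz _ _ _ ik kl il.
  have := onz _ _ _ ij jl il; have := onz _ _ _ ij jk ik.
  have opp a b c : orient a c b = - orient a b c by rewrite /orient; ring.
  have cyc a b c : orient b c a = orient a b c by rewrite /orient; ring.
  rewrite /s; set A := orient _ _ _; set B := orient _ _ _.
  set C := orient _ _ _; set D := orient _ _ _ => A0 B0 C0 D0.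
  rewrite !sign_neqE ?sign_eqE //.
  case/or3P=> /andP[h1 h2].
  - exists i, j, k, l; split=> //; apply: segments_cross => //.
    by rewrite (cyc (p i) (p k)) (cyc (p j) (p k)).
  - exists i, k, j, l; split.
      by rewrite /= !inE !negb_or ij ik il jl kl eq_sym jk.
    apply: segments_cross; first by rewrite opp.
    by rewrite (cyc (p i) (p j)) (opp (p j)) mulrN -mulNr.
  exists i, l, j, k; split.
    by rewrite /= !inE !negb_or ij ik il jk eq_sym jl eq_sym kl.
  apply: segments_cross; first by rewrite opp (opp _ (p k)) mulrNN.
  by rewrite (cyc (p i) (p j)).
have u (i j k l : nat) : uniq [:: i; j; k; l] -> all (gtn 5) [:: i; j; k; l] ->
    uniq [:: o i; o j; o k; o l].
  by rewrite /= !inE => us /and5P[i5 j5 k5 l5 _]; rewrite !oK.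
apply: contrapT => no_cross.
have {}cross i j k l (uijkl : uniq [:: i; j; k; l]) := contra_not (cross i j k l uijkl) no_cross.
(* For each of the five 4-subsets, alternating signs and crossing signs are both excluded; no
   assignment of signs to the ten triples meets all these constraints. *)
move: (area _ _ _ _ (u 0 1 2 3 isT isT)) (introN idP (cross _ _ _ _ (u 0 1 2 3 isT isT)))
      (area _ _ _ _ (u 0 1 2 4 isT isT)) (introN idP (cross _ _ _ _ (u 0 1 2 4 isT isT)))
      (area _ _ _ _ (u 0 1 3 4 isT isT)) (introN idP (cross _ _ _ _ (u 0 1 3 4 isT isT)))
      (area _ _ _ _ (u 0 2 3 4 isT isT)) (introN idP (cross _ _ _ _ (u 0 2 3 4 isT isT)))
      (area _ _ _ _ (u 1 2 3 4 isT isT)) (introN idP (cross _ _ _ _ (u 1 2 3 4 isT isT))).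
by clear; do 10!case: (s _ _ _).
Qed.

End FivePoints.

(** * From suitably placed clusters to crossings of minimum spanning trees *)

Section ClusterCrossings.
Variable R : realType.
Implicit Types (P X : {fset pt R}) (E F : {fset {fset pt R}}).

(** The [e i] are distinct edges of [E], and each contributes at least 1 to the outer sum through
    [f i]. *)
Lemma ncross_ge E F (I : finType) (e f : I -> {fset pt R}) :
  injective e -> (forall i, e i \in E) -> (forall i, f i \in F) ->
  (forall i, edges_cross (e i) (f i)) -> (#|I| <= ncross E F)%N.
Proof.
move=> inj_e eE fF ef; apply: (@leq_trans (count [in codom e] E)).
  rewrite -size_filter -(size_codom e); apply: uniq_leq_size.
    by rewrite map_inj_uniq ?enum_uniq.
  by move=> _ /codomP[i ->]; rewrite mem_filter codom_f eE.
rewrite -sum1_count big_mkcond /=; apply: leq_sum => x _.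
case: ifP => // /codomP[i ->].
by rewrite (bigD1_seq (f i)) ?fset_uniq ?fF //= asboolT.
Qed.

Lemma MST_ofP P X : generic P -> fsubset X P -> is_MST X (MST_of X).
Proof.
case=> _ gP /gP[T [mT _]]; rewrite /MST_of; case: pselect => [h|[]].
  by case: (cid h).
by exists T.
Qed.

Lemma generic_collinear P (p : 'I_5 -> pt R) :
  generic P -> injective p -> (forall i, p i \in P) ->
  forall i j k, i != j -> j != k -> i != k -> ~~ collinear (p i) (p j) (p k).
Proof. by case=> gP _ inj_p pP i j k ij jk ik; apply: gP; rewrite ?(inj_eq inj_p). Qed.

(* In the hypothesis, x and y range over all points of the clusters j <> i and
   the two points k, l of cluster i: this contains either colour class of the
   final colouring, whatever crossing pairs the clusters provide. *)
Lemma clusters_cr P (I : finType) (f : I * 'I_5 -> pt R) :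
  generic P -> injective f -> (forall x, f x \in P) ->
  (forall i k l, k != l -> exists S : pred (pt R),
     S (f (i, k)) != S (f (i, l)) /\
     forall x y, (x.1 = i -> x.2 \in [:: k; l]) -> (y.1 = i -> y.2 \in [:: k; l]) ->
       S (f x) != S (f y) -> [fset f x; f y] != [fset f (i, k); f (i, l)] ->
       dist (f (i, k)) (f (i, l)) < dist (f x) (f y)) ->
  exists2 Q, fsubset Q P & (#|I| <= cr Q)%N.
Proof.
move=> gP inj_f fP sep.
have /choice[abcd Habcd] : forall i, exists q : 'I_5 * 'I_5 * 'I_5 * 'I_5,
    uniq [:: q.1.1.1; q.1.1.2; q.1.2; q.2] /\
    exists z, on_seg z (f (i, q.1.1.1)) (f (i, q.1.1.2)) /\
              on_seg z (f (i, q.1.2)) (f (i, q.2)).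
  move=> i; have inj_fi : injective (fun k => f (i, k)) by move=> k l /inj_f[].
  have [a [b [c [d h]]]] := five_points_cross (generic_collinear gP inj_fi (fun k => fP (i, k))).
  by exists (a, b, c, d).
(* One colour class: two chosen points from every cluster. The fifth point of each cluster is
   dropped from [Q]. *)
pose sel (a b : I -> 'I_5) :=
  [fset x in P | `[< exists i k, k \in [:: a i; b i] /\ x = f (i, k) >]].
have selP a b x : reflect (exists i k, k \in [:: a i; b i] /\ x = f (i, k)) (x \in sel a b).
  apply: (iffP idP) => [|h]; rewrite !inE /=; first by case/andP=> _ /asboolP.
  by rewrite asboolT // andbT; case: h => i [k [_ ->]].
have selS a b : fsubset (sel a b) P by apply/fsubsetP=> x; rewrite !inE => /andP[].
have edge a b i : a i != b i -> [fset f (i, a i); f (i, b i)] \in MST_of (sel a b).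
  move=> ab; have [S [Sab ltab]] := sep i _ _ ab.
  apply: (MST_cut (S := S) (MST_ofP gP (selS a b))) => //.
  - by apply/selP; exists i, (a i); rewrite inE eqxx.
  - by apply/selP; exists i, (b i); rewrite !inE eqxx orbT.
  move=> _ _ /selP[j1 [k1 [h1 ->]]] /selP[j2 [k2 [h2 ->]]].
  by apply: ltab => /= e; rewrite -e.
pose a i := (abcd i).1.1.1; pose b i := (abcd i).1.1.2.
pose c i := (abcd i).1.2; pose d i := (abcd i).2.
have disj : [disjoint sel a b & sel c d]%fset.
  apply/fdisjointP=> _ /selP[i [k [h ->]]]; apply/selP=> -[j [l [h' /inj_f[e1 e2]]]].
  subst j l; have [] := Habcd i; rewrite -/(a i) -/(b i) -/(c i) -/(d i).
  move: h h'; rewrite /= !inE !negb_or => /orP[]/eqP-> /orP[]/eqP->;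
  by rewrite eqxx ?andbF.
exists (sel a b `|` sel c d); first by rewrite fsubUset !selS.
apply: (@leq_trans (crRB (sel a b) (sel c d))); last first.
  have -> : crRB (sel a b) (sel c d) = crRB (sel a b) ((sel a b `|` sel c d) `\` sel a b).
    by rewrite fsetDUl fsetDv fset0U; congr crRB; apply/esym/fsetDidPl; rewrite fdisjoint_sym.
  by apply: leq_bigmax_seq => //; rewrite fpowersetE fsubsetUl.
apply: (ncross_ge (e := fun i => [fset f (i, a i); f (i, b i)])
                  (f := fun i => [fset f (i, c i); f (i, d i)])).
- by move=> i j /fset2_eq[[/inj_f[]]|[/inj_f[]]].
- move=> i; apply: edge; have [] := Habcd i; rewrite -/(a i) -/(b i) /= !inE !negb_or.
  by case/andP=> /andP[].
- move=> i; apply: edge; have [] := Habcd i; rewrite -/(c i) -/(d i) /= !inE.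
  by case/and4P.
move=> i; have [_ [z [zab zcd]]] := Habcd i.
by exists (f (i, a i)), (f (i, b i)), (f (i, c i)), (f (i, d i)), z.
Qed.

End ClusterCrossings.

(** * Counting arguments *)

Lemma seq_pigeonhole (T : Type) (U : finType) (g : T -> U) (s : seq T) k :
  (k * #|U| < size s)%N -> exists c, (k < count (fun x => g x == c) s)%N.
Proof.
move=> ks; apply/existsP; apply: contraLR ks; rewrite negb_exists -leqNgt => /forallP h.
have -> : size s = (\sum_c count (fun x => g x == c) s)%N.
  elim: s {h} => [|x s IHs] /=; first by rewrite big1.
  rewrite big_split /= -IHs (bigD1 (g x)) //= eqxx big1 ?addn0 // => c.
  by move/negPf; rewrite eq_sym => ->.
apply: (@leq_trans (\sum_(c : U) k)%N); first by apply: leq_sum => c _; rewrite leqNgt h.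
by rewrite sum_nat_const mulnC.
Qed.

(** Select [p] with the least [rho] and discard its neighbours. By minimality all remaining
    neighbours have [rho] at least [rho p], so each selection costs at most [D] elements. *)
Lemma greedy_independent (R : realType) (T : finType) (rho : T -> R) (e : rel T) D :
  symmetric e -> reflexive e ->
  (forall p, (#|[set q | (rho p <= rho q)%R && e p q]| <= D)%N) ->
  exists2 A : {set T}, (#|T| <= D * #|A|)%N & {in A &, forall p q, p != q -> ~~ e p q}.
Proof.
move=> esym erefl hD.
suff [A AT [cA eA]] : exists2 A : {set T}, A \subset [set: T] &
    (#|[set: T]| <= D * #|A|)%N /\ {in A &, forall p q, p != q -> ~~ e p q}.
  by exists A; rewrite // -cardsT.
have [n] := ubnP #|[set: T]|; elim: n [set: T] => // n IHn S leSn.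
have [->|[p0 p0S]] := set_0Vmem S.
  by exists set0; rewrite ?sub0set // cards0; split=> // p q; rewrite inE.
pose p := [arg min_(q < p0 in S) rho q]%O.
have [pS minp] : p \in S /\ {in S, forall q, rho p <= rho q}.
  by rewrite /p; case: Order.TotalTheory.arg_minP.
pose N := [set q | (rho p <= rho q) && e p q].
have pN : p \in N by rewrite inE lexx erefl.
have ltSN : (#|S :\: N| < #|S|)%N.
  by apply/proper_card/properP; split; [exact: subsetDl|exists p; rewrite // inE pN].
have [|A AS [cA eA]] := IHn (S :\: N); first exact: leq_trans ltSN _.
have indep q : q \in A -> ~~ e p q.
  by move/(subsetP AS); rewrite !inE => /andP[/nandP[|//] h qS]; rewrite minp in h.
have pA : p \notin A by apply/negP => /indep; rewrite erefl.
exists (p |: A).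
  by rewrite subUset sub1set pS (subset_trans AS) // subsetDl.
split; last first.
  move=> q r; rewrite !inE => /orP[/eqP->|qA] /orP[/eqP->|rA]; first by rewrite eqxx.
  - by move=> _; exact: indep.
  - by move=> _; rewrite esym indep.
  - exact: eA.
rewrite cardsU1 pA mulnDr muln1 -(cardsID N S) leq_add //.
by apply: leq_trans (hD p); apply/subset_leq_card/subsetIr.
Qed.

(** Start with the element [p] of least [rho] and discard the window from [rho p] to [L * rho p],
    which holds at most [C] elements; everything left is at least [L * rho p]. *)
Lemma growing_chain (R : realType) (T : finType) (rho : T -> R) (L : R) (C : nat) :
  (0 < C)%N -> forall (t : nat) (N : {set T}),
  (forall q, (#|[set r in N | (rho q <= rho r < L * rho q)%R]| <= C)%N) ->
  (C * t <= #|N|)%N ->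
  exists s : seq T, [/\ size s = t, {subset s <= N} &
    sorted (fun q r => L * rho q <= rho r) s].
Proof.
move=> C0; elim=> [|t IHt] N hC leN; first by exists [::].
have [p0 p0N] : exists p0, p0 \in N.
  by apply/set0Pn; rewrite -card_gt0 (leq_trans _ leN) // muln_gt0 C0.
pose p := [arg min_(q < p0 in N) rho q]%O.
have [pN minp] : p \in N /\ {in N, forall q, rho p <= rho q}.
  by rewrite /p; case: Order.TotalTheory.arg_minP.
pose W := [set r in N | rho p <= rho r < L * rho p].
have [||s [size_s sub_s sorted_s]] := IHt (N :\: W).
- move=> q; apply: leq_trans (hC q); apply/subset_leq_card/subsetP=> r.
  by rewrite !inE => /andP[/andP[_ ->] ->].
- have := cardsID W N; have := subset_leq_card (subsetIr N W); have := hC p; rewrite -/W.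
  by rewrite mulnS in leN; lia.
exists (p :: s); split=> /=; first by rewrite size_s.
  by move=> q; rewrite inE => /orP[/eqP->//|/sub_s]; rewrite inE => /andP[].
case: s sub_s sorted_s {size_s} => //= q s sub_s ->; rewrite andbT.
have := sub_s q; rewrite !inE eqxx => /(_ isT)/andP[+ qN].
by rewrite qN minp //= -leNgt.
Qed.

(** * The sup norm and octants *)

Section SupDistance.
Variable R : realType.
Implicit Types a b c d : pt R.

Definition supd a b : R := Num.max `|a.1 - b.1| `|a.2 - b.2|.

Lemma supd_leE a b r : (supd a b <= r) = (`|a.1 - b.1| <= r) && (`|a.2 - b.2| <= r).
Proof. by rewrite /supd ge_max. Qed.

Lemma supdC a b : supd a b = supd b a.
Proof. by rewrite /supd distrC (distrC a.2). Qed.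

Lemma supdxx a : supd a a = 0.
Proof. by rewrite /supd !subrr normr0 maxxx. Qed.

Lemma supd_ge0 a b : 0 <= supd a b.
Proof. by rewrite /supd le_max normr_ge0. Qed.

Lemma supd_gt0 a b : a != b -> 0 < supd a b.
Proof.
move=> ab; rewrite lt_neqAle supd_ge0 andbT eq_sym; apply: contra ab => /eqP ab.
have : supd a b <= 0 by rewrite ab.
rewrite supd_leE !normr_le0 !subr_eq0 => /andP[/eqP e1 /eqP e2].
by case: a b e1 e2 {ab} => ? ? [? ?] /= -> ->.
Qed.

Lemma supd_triangle b a c : supd a c <= supd a b + supd b c.
Proof.
have [h1 h2] : `|a.1 - b.1| <= supd a b /\ `|a.2 - b.2| <= supd a b.
  by apply/andP; rewrite -supd_leE.
have [h3 h4] : `|b.1 - c.1| <= supd b c /\ `|b.2 - c.2| <= supd b c.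
  by apply/andP; rewrite -supd_leE.
rewrite supd_leE; apply/andP; split.
  by rewrite -(subrKA b.1) (le_trans (ler_normD _ _)) // lerD.
by rewrite -(subrKA b.2) (le_trans (ler_normD _ _)) // lerD.
Qed.

Definition sqd a b : R := (a.1 - b.1) ^+ 2 + (a.2 - b.2) ^+ 2.

Lemma dist_lt a b c d : sqd a b < sqd c d -> dist a b < dist c d.
Proof.
move=> lt; rewrite /dist ltr_sqrt //; apply: le_lt_trans lt.
by rewrite addr_ge0 // sqr_ge0.
Qed.

(** Euclidean distance lies between the sup distance and sqrt 2 times it, and sqrt 2 < 2. *)
Lemma supd_dist_lt a b c d : 2 * supd a b < supd c d -> dist a b < dist c d.
Proof.
move=> lt; apply: dist_lt.
have : sqd a b <= 2 * supd a b ^+ 2.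
  have /andP[h1 h2] : (`|a.1 - b.1| <= supd a b) && (`|a.2 - b.2| <= supd a b).
    by rewrite -supd_leE.
  rewrite /sqd -!(real_normK (num_real (_ - _))) mulr_natl mulr2n.
  by apply: lerD; rewrite lerXn2r ?nnegrE // supd_ge0.
have : supd c d ^+ 2 <= sqd c d.
  rewrite /sqd /supd maxEle; case: ifP => _.
    by rewrite real_normK ?num_real // lerDr sqr_ge0.
  by rewrite real_normK ?num_real // lerDl sqr_ge0.
have := supd_ge0 a b; have := supd_ge0 c d; nra.
Qed.

Definition octant p a : bool * bool * bool :=
  (0 <= a.1 - p.1, 0 <= a.2 - p.2, `|a.1 - p.1| <= `|a.2 - p.2|).

Definition infd a b : R := Num.min `|a.1 - b.1| `|a.2 - b.2|.

Lemma infd_bounds a b : 0 <= infd a b <= supd a b.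
Proof. by rewrite /infd le_min !normr_ge0 /supd le_max ge_min lexx. Qed.

(* Relative to p, the pair (supd p a, infd p a) is the image of a in a fixed
   octant under a symmetry of the square. *)
Lemma sqd_octant p a b : octant p a = octant p b ->
  sqd a b = (supd p a - supd p b) ^+ 2 + (infd p a - infd p b) ^+ 2.
Proof.
case=> h1 h2 h3.
have absd (x y z : R) : (0 <= y - x) = (0 <= z - x) -> (y - z) ^+ 2 = (`|x - y| - `|x - z|) ^+ 2.
  move=> h; rewrite !(distrC x); have [hy|hy] := leP 0 (y - x).
    by rewrite (ger0_norm hy) ger0_norm -?h //; ring.
  by rewrite (ltr0_norm hy) ltr0_norm ?ltNge -?h -?ltNge //; ring.
rewrite /sqd (absd _ _ _ h1) (absd _ _ _ h2) /supd /infd !minEle !maxEle.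
rewrite !(distrC p.1) !(distrC p.2) -h3.
by case: ifP => _; ring.
Qed.

(** Case where [y] lies beyond [b]: the left side is at most [2 * ub ^+ 2], while [uy - ux] is at
    least [3 * ub]. *)
Lemma spread_far (ua va ub vb ux vx uy vy : R) :
  0 <= va /\ va <= ua -> 0 <= vb /\ vb <= ub ->
  0 < ua -> 4 * ua <= ub -> ux <= ua -> 4 * ub <= uy ->
  (ua - ub) ^+ 2 + (va - vb) ^+ 2 < (ux - uy) ^+ 2 + (vx - vy) ^+ 2.
Proof.
move=> [? ?] [? ?] ? ? ? ?.
have h1 : (3 * ub) ^+ 2 <= (ux - uy) ^+ 2 by rewrite -(opprB uy) sqrrN lerXn2r ?nnegrE; lra.
have h2 : (ua - ub) ^+ 2 <= ub ^+ 2 by rewrite -(opprB ub) sqrrN lerXn2r ?nnegrE; lra.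
have h3 : (va - vb) ^+ 2 <= ub ^+ 2.
  by rewrite -(real_normK (num_real (va - vb))) lerXn2r ?nnegrE ?ler_norml //; lra.
have : 0 <= (vx - vy) ^+ 2 by exact: sqr_ge0.
have : 0 < ub ^+ 2 by rewrite exprn_gt0 //; lra.
rewrite exprMn in h1; lra.
Qed.

(** Case [y = b] with [x] before [a]. Factoring the difference of the two sides gives a first
    product of at least 9/8 [ua * ub]; the second is at least -1/2 [ua * ub], because [v] stays
    between 0 and [u] in the octant. *)
Lemma spread_near (ua va ub vb ux vx : R) :
  0 <= vx /\ vx <= ux -> 0 <= va /\ va <= ua -> 0 <= vb /\ vb <= ub ->
  0 < ua -> 4 * ua <= ub -> 4 * ux <= ua ->
  (ua - ub) ^+ 2 + (va - vb) ^+ 2 < (ux - ub) ^+ 2 + (vx - vb) ^+ 2.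
Proof.
move=> [? ?] [? ?] [? ?] ? ? ?; rewrite -subr_gt0.
have -> : (ux - ub) ^+ 2 + (vx - vb) ^+ 2 - ((ua - ub) ^+ 2 + (va - vb) ^+ 2) =
  (ua - ux) * (2 * ub - ua - ux) + (va - vx) * (2 * vb - va - vx) by ring.
have h : (3 * ua) * (6 * ub) <= (4 * (ua - ux)) * (4 * (2 * ub - ua - ux)).
  by apply: ler_pM; lra.
have pos : 0 < ua * ub by rewrite mulr_gt0 //; lra.
have [vxa|vax] := leP vx va; last first.
  have h' : (vx - va) * (2 * vb - va - vx) <= (ua / 4) * (2 * ub).
    by apply: le_trans (ler_wpM2l _ (_ : _ <= 2 * ub)) (ler_wpM2r _ _); lra.
  lra.
have h' : (va - vx) * (va + vx - 2 * vb) <= ua * (ub / 2).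
  by apply: le_trans (ler_wpM2l _ (_ : _ <= ub / 2)) (ler_wpM2r _ _); lra.
lra.
Qed.

(** On a geometrically growing chain in one octant, [ab] is the shortest pair across the cut between
    [a] and [b]: [x] is [a] or an earlier point, [y] is [b] or a later one. *)
Lemma chain_dist_lt p a b x y :
  octant p a = octant p x -> octant p b = octant p x -> octant p y = octant p x ->
  0 < supd p a -> 4 * supd p a <= supd p b ->
  x = a \/ 4 * supd p x <= supd p a -> y = b \/ 4 * supd p b <= supd p y ->
  [fset x; y] != [fset a; b] -> dist a b < dist x y.
Proof.
move=> oa ob oy a0 ab xa yb ne; apply: dist_lt.
rewrite !(@sqd_octant p) ?oa ?ob ?oy //.
have := infd_bounds p a; have := infd_bounds p b.
have := infd_bounds p x; have := infd_bounds p y.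
move: ne; case: xa yb => [->|hx] [->|hy]; first by rewrite eqxx.
- move=> _ /andP[vy0 vy] _ /andP[vb0 vb] /andP[va0 va].
  exact: spread_far (conj va0 va) (conj vb0 vb) _ _ _ _.
- move=> _ _ /andP[vx0 vx] /andP[vb0 vb] /andP[va0 va].
  exact: spread_near (conj vx0 vx) (conj va0 va) (conj vb0 vb) _ _ _.
move=> _ /andP[vy0 vy] /andP[vx0 vx] /andP[vb0 vb] /andP[va0 va].
apply: spread_far (conj va0 va) (conj vb0 vb) _ _ _ _ => //; lra.
Qed.

End SupDistance.

(** * Chains and balls *)

Section ManyCrossings.
Variable R : realType.

Lemma cr_ge0_subset (P : {fset pt R}) : exists2 Q, fsubset Q P & (0 <= cr Q)%N.
Proof. by exists fset0; rewrite ?fsub0set. Qed.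

Lemma chain_cr (P : {fset pt R}) (p : pt R) (s : seq (pt R)) m :
  generic P -> {subset s <= P} ->
  sorted (fun a b => (0 < supd p a) && (4 * supd p a <= supd p b)) s ->
  (40 * m <= size s)%N -> exists2 Q, fsubset Q P & (m <= cr Q)%N.
Proof.
case: m => [|m] gP sP sorted_s le_s; first exact: cr_ge0_subset.
set r := fun a b => _ in sorted_s.
have r_trans : transitive r.
  move=> b a c /andP[a0 ab] /andP[b0 bc]; rewrite /r a0 /=.
  by apply: le_trans bc; lra.
(* Exceeding [5 * m.+1 - 1] in one of the 8 octants means having [5 * m.+1] points there, enough for
   [m.+1] blocks of five. *)
have [|c] := @seq_pigeonhole _ _ (octant p) s (5 * m.+1).-1.
  by rewrite !card_prod !card_bool; lia.
rewrite -size_filter; set s' := filter _ s => gt_s'.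
have sorted_s' : sorted r s' by apply: sorted_filter.
have s'P : {subset s' <= P} by move=> x; rewrite mem_filter => /andP[_ /sP].
have s'c : {in s', forall x, octant p x = c} by move=> x; rewrite mem_filter => /andP[/eqP].
clearbody s'; move: {s le_s sP sorted_s} s' sorted_s' s'P s'c gt_s' => s sorted_s sP sc size_s.
pose z n := nth (0, 0) s n.
have zs n : (n < size s)%N -> z n \in s by move=> ns; apply: mem_nth.
have lt_r n k : (n < k)%N -> (k < size s)%N -> r (z n) (z k).
  move=> nk ks; apply: (sorted_ltn_nth r_trans) => //; rewrite inE //.
  exact: ltn_trans ks.
have r_lt a b : r a b -> supd p a < supd p b by case/andP=> ? ?; lra.
have zle n k : (n < size s)%N -> (k < size s)%N -> (supd p (z n) <= supd p (z k)) = (n <= k)%N.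
  move=> ns ks; case: leqP => [|kn]; last by apply/negbTE; rewrite -ltNge; apply/r_lt/lt_r.
  by rewrite leq_eqVlt => /orP[/eqP->|nk]; rewrite ?lexx // ltW //; apply/r_lt/lt_r.
pose idx (x : 'I_m.+1 * 'I_5) : nat := (5 * x.1 + x.2)%N.
have idx_size x : (idx x < size s)%N by rewrite /idx; case: x => -[i i5] [k k5] /=; lia.
have idx_inj : injective idx.
  move=> [[i i5] [k k5]] [[j j5] [l l5]]; rewrite /idx /= => e.
  have eij : i = j by lia.
  have ekl : k = l by lia.
  by subst; congr (_, _); apply: val_inj.
have f_inj : injective (z \o idx).
  move=> x y; rewrite [LHS]/= [RHS]/= => exy; apply/idx_inj/eqP; rewrite eqn_leq.
  by rewrite -(zle _ _ (idx_size x)) // -(zle _ _ (idx_size y)) // exy !lexx.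
have [||Q QP crQ] := @clusters_cr R P _ (z \o idx) gP f_inj; first by move=> x; apply/sP/zs.
  move=> i k l; wlog lt_kl : k l / (k < l)%N => [wlog_lt ne_kl|_].
    have [||eq_kl] := ltngtP k l; last by rewrite (val_inj eq_kl) eqxx in ne_kl.
      by move=> lt_kl; apply: wlog_lt.
    move=> lt_lk; have [|S [S1 S2]] := wlog_lt _ _ lt_lk; first by rewrite eq_sym.
    exists S; split=> [|x y x1 y1 Sxy]; first by rewrite eq_sym.
    rewrite [X in _ != X]fsetUC => ne.
    rewrite [X in X < _](_ : _ = dist ((z \o idx) (i, l)) ((z \o idx) (i, k))).
      by apply: S2 => //; [move/x1 | move/y1]; rewrite !inE orbC.
    by rewrite /dist; congr Num.sqrt; ring.
  (* The cut is the sup ball around [p] reaching to the nearer point of the pair. *)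
  exists (fun x => supd p x <= supd p (z (idx (i, k)))) => /=.
  rewrite lexx zle // leqNgt (_ : (idx (i, k) < idx (i, l))%N) /=; last by rewrite ltn_add2l.
  split=> // x y; wlog le_xy : x y / (idx x <= idx y)%N => [wlog_le|].
    have [le|lt] := leqP (idx x) (idx y); first exact: wlog_le.
    move=> x1 y1 Sxy ne.
    rewrite [X in _ < X](_ : _ = dist (z (idx y)) (z (idx x))).
      by apply: wlog_le => //; [exact: ltnW | rewrite eq_sym | rewrite fsetUC].
    by rewrite /dist; congr Num.sqrt; ring.
  move=> x1 y1; rewrite !zle // => Sxy ne.
  have /andP[xk ky] : (idx x <= idx (i, k) < idx y)%N.
    by move: Sxy le_xy; case: leqP; case: leqP => //=; lia.
  have /lt_r/(_ (idx_size _))/andP[zk0 zkl] : (idx (i, k) < idx (i, l))%N by rewrite ltn_add2l.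
  apply: (@chain_dist_lt _ p) => //; rewrite ?sc ?zs //.
    have [->|nx] := eqVneq x (i, k); [by left | right].
    have /lt_r/(_ (idx_size _))/andP[] // : (idx x < idx (i, k))%N.
    by rewrite ltn_neqAle xk andbT (inj_eq idx_inj).
  have [->|ny] := eqVneq y (i, l); [by left | right].
  (* A point after [(i, k)] in the same block must be [l], since only [k] and [l] are kept there; a
     point of a later block comes after the whole block [i]. *)
  have /lt_r/(_ (idx_size _))/andP[] // : (idx (i, l) < idx y)%N.
  case: y y1 ky ny {Sxy ne le_xy} => j n y1 ky ny; rewrite /idx /= in y1 ky *.
  have [ji|nji] := eqVneq j i; last first.
    move: (ltn_ord k) (ltn_ord l) (ltn_ord n) => k5 l5 n5.
    have {}nji : (j : nat) != i by rewrite val_eqE.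
    by lia.
  move: ny (y1 ji) ky; rewrite ji !inE xpair_eqE eqxx /= => /negPf->; rewrite orbF.
  by move/eqP=> ->; rewrite ltnn.
by exists Q; rewrite // -[m.+1]card_ord.
Qed.

(** The content of a ball changes only at distances from [p] to points, so the least radius is a
    minimum over finitely many distances. It is positive because the ball contains a point other
    than [p]. *)
Lemma core_radius (T : finType) (pos : T -> pt R) (p : T) :
  injective pos -> (5 <= #|T|)%N ->
  exists r, [/\ 0 < r, (5 <= #|[set q | (supd (pos p) (pos q) <= r)%R]|)%N,
    exists z, supd (pos p) (pos z) = r &
    forall r', (5 <= #|[set q | (supd (pos p) (pos q) <= r')%R]|)%N -> r <= r'].
Proof.
move=> inj_pos T5; pose B r := [set q | supd (pos p) (pos q) <= r].
pose big z := (5 <= #|B (supd (pos p) (pos z))|)%N.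
have big_sub r : (5 <= #|B r|)%N -> exists2 z, big z & supd (pos p) (pos z) <= r.
  move=> r5; have [z0 z0B] : exists z0, z0 \in B r.
    by apply/set0Pn; rewrite -card_gt0; apply: leq_trans r5.
  pose z := [arg max_(z > z0 in B r) supd (pos p) (pos z)]%O.
  have [zB maxz] : z \in B r /\ {in B r, forall q, supd (pos p) (pos q) <= supd (pos p) (pos z)}.
    by rewrite /z; case: Order.TotalTheory.arg_maxP.
  exists z; last by rewrite inE in zB.
  by apply: (leq_trans r5); apply/subset_leq_card/subsetP=> q /maxz; rewrite inE.
have [z0 bz0] : exists z, big z.
  pose M := \big[Num.max/0]_q supd (pos p) (pos q).
  have [|z bz _] := big_sub M; last by exists z.
  apply: leq_trans T5 _; rewrite -cardsT; apply/subset_leq_card/subsetP=> q _.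
  by rewrite inE /M (bigD1 q) //= le_max lexx.
pose z := [arg min_(z < z0 | big z) supd (pos p) (pos z)]%O.
have [bz minz] : big z /\ forall q, big q -> supd (pos p) (pos z) <= supd (pos p) (pos q).
  by rewrite /z; case: Order.TotalTheory.arg_minP.
exists (supd (pos p) (pos z)); split=> //; last 1 first.
- by move=> r' /big_sub[q /minz h]; exact: le_trans.
- have [q] : exists q, q \in B (supd (pos p) (pos z)) :\ p.
    apply/set0Pn; rewrite -card_gt0; have := bz; rewrite /big (cardsD1 p).
    by case: (p \in _); lia.
  rewrite !inE => /andP[qp]; apply: lt_le_trans.
  by apply: supd_gt0; rewrite (inj_eq inj_pos) eq_sym.
by exists z.
Qed.

Lemma grid_cell_bound (M h x y : R) :
  0 < h -> `|x - y| <= M -> 0 <= (y - x + M) / h <= 2 * M / h.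
Proof.
move=> h0; rewrite ler_norml => /andP[? ?].
by rewrite divr_ge0 ?ler_pM2r ?invr_gt0; lra.
Qed.

(** Adding [M] makes the scaled coordinates nonnegative, so [truncn] is their floor, and equal
    floors leave a difference below 1. *)
Lemma grid_cell_close (M h x y y' : R) :
  0 < h -> `|x - y| <= M -> `|x - y'| <= M ->
  Num.truncn ((y - x + M) / h) = Num.truncn ((y' - x + M) / h) -> `|y - y'| <= h.
Proof.
move=> h0 /(grid_cell_bound h0)/andP[y0 _] /(grid_cell_bound h0)/andP[y0' _] e.
have /andP[l u] := truncn_itv y0; have /andP[l' u'] := truncn_itv y0'.
rewrite -e -natr1 in l' u'; rewrite -natr1 in u.
have -> : y - y' = ((y - x + M) / h - (y' - x + M) / h) * h.
  by rewrite mulrBl !divfK ?gt_eqF //; ring.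
rewrite normrM (gtr0_norm h0) ler_piMl ?(ltW h0) // ler_norml.
by apply/andP; split; lra.
Qed.

(** Packing: the points in question lie within [c * L * a] of [p]. Five of them in one grid cell of
    side [a / 2] would give one of them a five-point ball of radius [a / 2], contradicting
    [a <= rho q]. The bound depends on [c] and [L] only. *)
Lemma window_card (c L : R) : exists2 C, (0 < C)%N &
  forall (T : finType) (pos : T -> pt R) (rho : T -> R) (p : pt R) (a : R),
  (forall q r, (5 <= #|[set q' | (supd (pos q) (pos q') <= r)%R]|)%N -> rho q <= r) ->
  0 <= c -> 0 < a ->
  (#|[set q | (supd p (pos q) <= c * rho q) && (a <= rho q < L * a)]%R| <= C)%N.
Proof.
(* With [M = c * (L * a)] and cell side [a / 2], a coordinate spans [2 * M / (a / 2) = 4 * (c * L)]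
   cell widths, independently of [a]. *)
pose K := Num.truncn (4 * (c * L)).
exists (4 * #|{: 'I_K.+1 * 'I_K.+1}|)%N; first by rewrite muln_gt0 card_prod !card_ord.
move=> T pos rho p a rhoP c0 a0; rewrite leqNgt; apply/negP; set W := [set q | _].
have h0 : 0 < a / 2 by rewrite divr_gt0.
pose M := c * (L * a).
pose cell (x y : R) : 'I_K.+1 := inord (Num.truncn ((y - x + M) / (a / 2))).
have cell_close x y y' : `|x - y| <= M -> `|x - y'| <= M ->
    cell x y = cell x y' -> `|y - y'| <= a / 2.
  have MK : 2 * M / (a / 2) = 4 * (c * L) by rewrite /M; field; rewrite gt_eqF.
  have bnd t : `|x - t| <= M -> (Num.truncn ((t - x + M) / (a / 2)) < K.+1)%N.
    by move=> /(grid_cell_bound h0)/andP[t0 tK]; rewrite ltnS le_truncn // -MK.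
  move=> xy xy' /(congr1 val) /=; rewrite !inordK ?bnd //.
  exact: grid_cell_close.
rewrite cardE => /(seq_pigeonhole (fun q => (cell p.1 (pos q).1, cell p.2 (pos q).2)))[c1].
rewrite -size_filter; set F := filter _ _ => F5.
have uF : uniq F by rewrite filter_uniq ?enum_uniq.
have [q qF] : exists q, q \in F by case: F F5 {uF} => // q F _; exists q; rewrite inE eqxx.
have FW q' : q' \in F -> [/\ supd p (pos q') <= M, a <= rho q'
    & (cell p.1 (pos q').1, cell p.2 (pos q').2) = c1].
  rewrite mem_filter mem_enum inE => /andP[/eqP-> /and3P[h1 h2 h3]]; split=> //.
  by apply: le_trans h1 _; rewrite ler_wpM2l // ltW.
have [pq aq cq] := FW _ qF.
suff /rhoP : (5 <= #|[set q' | (supd (pos q) (pos q') <= a / 2)%R]|)%N by lra.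
apply: leq_trans F5 _; rewrite -(card_uniqP uF); apply/subset_leq_card/subsetP=> q' q'F.
have [pq' _ cq'] := FW _ q'F; move: pq pq'; rewrite inE !supd_leE => /andP[x1 x2] /andP[x1' x2'].
rewrite -cq in cq'; case: cq' => e1 e2.
by rewrite (cell_close p.1) // (cell_close p.2).
Qed.

End ManyCrossings.

Lemma injection_ord (T : finType) (A : {set T}) n :
  (n <= #|A|)%N -> exists2 g : 'I_n -> T, injective g & forall k, g k \in A.
Proof.
move=> nA; exists (fun k => enum_val (widen_ord nA k)) => [k l /enum_val_inj|k].
  by move/(congr1 val) => /= kl; apply: val_inj.
exact: enum_valP.
Qed.

(** * Dichotomy: separated clusters or a crowded point *)

Section Dichotomy.
Variable R : realType.
Variables (P : {fset pt R}) (T : finType) (pos : T -> pt R) (rho : T -> R).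
Hypothesis gP : generic P.
Hypothesis inj_pos : injective pos.
Hypothesis posP : forall q, pos q \in P.
Hypothesis rho_gt0 : forall q, 0 < rho q.

(** Around each centre take five points within [rho]. Points of different clusters are more than 10
    - 1 - 1 = 8 radii apart, points of one cluster at most 2, which leaves room for the factor 2
    between the norms. *)
Lemma separated_cr (A : {set T}) :
  (forall p, (5 <= #|[set q | (supd (pos p) (pos q) <= rho p)%R]|)%N) ->
  {in A &, forall p q, p != q ->
     10 * Num.max (rho p) (rho q) < supd (pos p) (pos q)} ->
  exists2 Q, fsubset Q P & (#|A| <= cr Q)%N.
Proof.
move=> ball5 sepA.
have /choice[g Hg] : forall p, exists g : 'I_5 -> T,
    injective g /\ forall k, supd (pos p) (pos (g k)) <= rho p.
  move=> p; have [g inj_g gB] := injection_ord (ball5 p).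
  by exists g; split=> // k; have := gB k; rewrite inE.
pose c (i : 'I_#|A|) : T := enum_val i.
pose f (x : 'I_#|A| * 'I_5) := pos (g (c x.1) x.2).
have fc x : supd (pos (c x.1)) (f x) <= rho (c x.1) by have [_] := Hg (c x.1); apply.
have far x y : x.1 != y.1 -> 8 * rho (c x.1) < supd (f x) (f y).
  move=> xy; have := sepA _ _ (enum_valP x.1) (enum_valP y.1); rewrite (inj_eq enum_val_inj).
  move/(_ xy); rewrite -!/(c _).
  have := supd_triangle (f x) (pos (c x.1)) (pos (c y.1)).
  have := supd_triangle (f y) (f x) (pos (c y.1)).
  have := fc x; have := fc y; rewrite (supdC (f y)).
  have : rho (c x.1) <= Num.max (rho (c x.1)) (rho (c y.1)) by rewrite le_max lexx.
  have : rho (c y.1) <= Num.max (rho (c x.1)) (rho (c y.1)) by rewrite le_max lexx orbT.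
  lra.
have f_inj : injective f.
  move=> [i k] [j l] e; have [ij|/(far (i, k) (j, l))] := eqVneq i j.
    by move: e; rewrite /f /= ij => /inj_pos; have [gi _] := Hg (c j) => /gi->.
  by rewrite e supdxx pmulr_rlt0 ?ltr0n //= ltNge ltW ?rho_gt0.
have [||Q QP crQ] := @clusters_cr R P _ f gP f_inj; first by move=> x; exact: posP.
  (* The cut isolates a single point: its only kept companion in the cluster is [l], and all other
     points are far away. *)
  move=> i k l kl; exists (pred1 (f (i, k))) => /=.
  rewrite eqxx [f (i, l) == _](inj_eq f_inj) xpair_eqE eqxx [l == k]eq_sym (negPf kl).
  split=> // x y.
  wlog -> : x y / x = (i, k) => [wlog_x x1 y1|_].
    have [ex|nx] := eqVneq (f x) (f (i, k)).
      by have := wlog_x x y (f_inj _ _ ex) x1 y1; rewrite ex eqxx.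
    have [ey _ ne|//] := eqVneq (f y) (f (i, k)).
    have -> : dist (f x) (f y) = dist (f y) (f x) by rewrite /dist; congr Num.sqrt; ring.
    apply: (wlog_x y x (f_inj _ _ ey) y1 x1); first by rewrite ey eqxx (negPf nx).
    by rewrite fsetUC.
  move=> y1; rewrite eqxx => yk ne; apply: supd_dist_lt.
  have yi : i != y.1.
    apply/negP=> /eqP iy; case: y iy y1 yk ne => j n /= <- /(_ erefl).
    by rewrite !inE => /orP[]/eqP->; rewrite eqxx.
  have := far (i, k) y yi; have := fc (i, k); have := fc (i, l).
  have := supd_triangle (pos (c i)) (f (i, k)) (f (i, l)); rewrite (supdC (f _) (pos _)) /=.
  by have := rho_gt0 (c i); lra.
by exists Q; rewrite // -[X in (X <= _)%N]card_ord.
Qed.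

(* 40 = 8 octants times clusters of 5 points.  Each q yields a point at distance
   between rho q / 2 and 11 rho q from p, so that radii growing by the factor
   88 = 4 * 2 * 11 give distances growing by the factor 4. *)
Lemma crowded_cr (p : T) (N : {set T}) C m :
  (forall q, exists z, supd (pos q) (pos z) = rho q) ->
  (0 < C)%N ->
  (forall a, 0 < a -> (#|[set q in N | (a <= rho q < 88 * a)%R]| <= C)%N) ->
  {in N, forall q, supd (pos p) (pos q) <= 10 * rho q} ->
  (C * (40 * m) <= #|N|)%N ->
  exists2 Q, fsubset Q P & (m <= cr Q)%N.
Proof.
move=> rho_attained C0 hC nearN leN.
have [s [size_s sN sorted_s]] := growing_chain C0 (fun q => hC _ (rho_gt0 q)) leN.
(* Take [q] itself unless it is closer to [p] than [rho q / 2]; then a point at distance exactly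
   [rho q] from [q] is farther than [rho q / 2] from [p]. *)
have /choice[z Hz] : forall q, exists z, q \in N ->
    rho q <= 2 * supd (pos p) (pos z) /\ supd (pos p) (pos z) <= 11 * rho q.
  move=> q; have [z qz] := rho_attained q; have r0 := rho_gt0 q.
  have [h|h] := leP (rho q) (2 * supd (pos p) (pos q)).
    by exists q => /nearN hq; split=> //; apply: le_trans hq _; rewrite ler_pM2r ?ler_nat.
  exists z => /nearN hq; move: hq h r0.
  have := supd_triangle (pos q) (pos p) (pos z).
  have := supd_triangle (pos p) (pos q) (pos z); rewrite qz (supdC (pos q)).
  move: (supd _ (pos z)) (supd _ _) (rho q) => u v w.
  by clear; move=> *; split; lra.
apply: (@chain_cr _ P (pos p) [seq pos (z q) | q <- s]) => //.
- by move=> _ /mapP[q _ ->].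
- rewrite sorted_map; apply: sub_in_sorted sorted_s; last by apply/allP; exact: sN.
  move=> q r /Hz[h1 h2] /Hz[h3 h4] /= h5; have := rho_gt0 q.
  by move=> h; apply/andP; split; lra.
by rewrite size_map size_s.
Qed.

End Dichotomy.

(** The threshold [D = C * (40 * m)] balances the two cases: a point with [D] conflicts of at least
    its own radius yields [m] crossings by [crowded_cr]; otherwise the greedy choice keeps at least
    [#|P| / D], hence [m], separated points. *)
Lemma cr_sqrt_bound (R : realType) : exists2 C, (0 < C)%N &
  forall (P : {fset pt R}) m, generic P -> (C * (m * m) <= #|` P|)%N ->
    exists2 Q, fsubset Q P & (m <= cr Q)%N.
Proof.
(* 10 is the conflict factor, 88 the growth of radii required by [crowded_cr]. *)
have [C C0 hC] := window_card (10 : R) 88.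
exists (40 * C)%N => [|P [|m] gP]; [by rewrite muln_gt0 C0 | by move=> _; exact: cr_ge0_subset |].
rewrite cardfE => leP; pose T : finType := P; pose pos (q : T) : pt R := val q.
have inj_pos : injective pos by exact: val_inj.
have posP q : pos q \in P by exact: valP.
have T5 : (5 <= #|T|)%N by apply: leq_trans leP; nia.
have /choice[rho Hrho] := fun p => core_radius p inj_pos T5.
have rho_gt0 q : 0 < rho q by have [] := Hrho q.
have rho_ball q : (5 <= #|[set q' | (supd (pos q) (pos q') <= rho q)%R]|)%N by have [] := Hrho q.
have rho_min q r : (5 <= #|[set q' | (supd (pos q) (pos q') <= r)%R]|)%N -> rho q <= r.
  by have [_ _ _] := Hrho q; apply.
have rho_attained q : exists z, supd (pos q) (pos z) = rho q by have [] := Hrho q.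
pose e p q := supd (pos p) (pos q) <= 10 * Num.max (rho p) (rho q).
pose N p := [set q | (rho p <= rho q) && e p q].
have nearN p : {in N p, forall q, supd (pos p) (pos q) <= 10 * rho q}.
  by move=> q; rewrite inE => /andP[pq]; rewrite /e max_r.
have [/existsP[p leNp]|/existsPn ltN] := boolP [exists p, C * (40 * m.+1) <= #|N p|]%N.
  apply: (crowded_cr (p := p) gP posP rho_gt0 rho_attained C0 _ _ leNp) => // a a0.
  apply: leq_trans (hC T pos rho (pos p) a rho_min _ a0) => //.
  apply/subset_leq_card/subsetP=> q; rewrite inE => /andP[qN aq].
  by rewrite inE aq andbT nearN.
have [||p|A leA sepA] := @greedy_independent R T rho e (C * (40 * m.+1))%N.
- by move=> p q; rewrite /e supdC maxC.
- by move=> p; rewrite /e supdxx mulr_ge0 // le_max ltW ?rho_gt0.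
- by apply: ltnW; rewrite ltnNge ltN.
have [|Q QP crQ] := @separated_cr R P T pos rho gP inj_pos posP rho_gt0 A rho_ball.
  by move=> p q pA qA pq; rewrite ltNge; exact: sepA.
exists Q => //; apply: leq_trans crQ.
have : (40 * C * (m.+1 * m.+1) <= 40 * C * m.+1 * #|A|)%N.
  by apply: leq_trans leP _; apply: leq_trans leA _; rewrite (mulnCA C) mulnA.
by rewrite !mulnA leq_pmul2l // !muln_gt0 C0.
Qed.

(** * From the square root to the squared logarithm *)

Lemma sqrtr_ge1 (R : realType) (x : R) : 1 <= x -> 1 <= Num.sqrt x.
Proof. by move=> x1; rewrite -[leLHS]sqrtr1 ler_wsqrtr. Qed.

(** For [w] the fourth root of [x], [ln x = 4 * ln w <= 4 * w]; now square. *)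
Lemma ln_sqr_le (R : realType) (x : R) : 1 <= x -> ln x ^+ 2 <= 16 * Num.sqrt x.
Proof.
move=> x1; pose w := Num.sqrt (Num.sqrt x).
have w1 : 1 <= w by rewrite !sqrtr_ge1.
have w2 : w ^+ 2 = Num.sqrt x by rewrite sqr_sqrtr ?sqrtr_ge0.
have w4 : w ^+ 4 = x by rewrite (exprM w 2 2) w2 sqr_sqrtr //; lra.
have lw : ln w <= w by apply/ltW/ln_sublinear; lra.
have lw0 : 0 <= ln w by rewrite ln_ge0.
have lwx : ln x = 4 * ln w by rewrite mulr_natl -lnXn ?w4 //; lra.
have : ln w ^+ 2 <= w ^+ 2 by rewrite lerXn2r ?nnegrE //; lra.
by rewrite lwx -w2 exprMn; lra.
Qed.

Theorem theorem3 (R : realType) :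
  exists (c : R) (n0 : nat), 0 < c /\
    forall P : {fset pt R}, generic P -> (n0 <= #|` P|)%N ->
      exists Q : {fset pt R}, fsubset Q P /\
        c * (log2 (#|` P|%:R : R)) ^+ 2 <= (cr Q)%:R.
Proof.
have [C C0 hC] := cr_sqrt_bound R.
have l2 : 0 < ln (2 : R) by rewrite ln_gt0 //; lra.
pose K : R := C%:R.
have K0 : 0 < K by rewrite ltr0n.
have sK0 : 0 < Num.sqrt K by rewrite sqrtr_gt0.
(* 16 comes from [ln_sqr_le]; a further factor 2 pays for rounding [y = sqrt (n / C)] down to [m],
   as [y < m + 1 <= 2 * m]. Taking [n0 = C] ensures [m >= 1]. *)
exists (ln 2 ^+ 2 / (32 * Num.sqrt K)), C; split.
  by rewrite divr_gt0 ?exprn_gt0 // mulr_gt0.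
move=> P gP leP; set n : R := #|` P|%:R.
have Kn : K <= n by rewrite ler_nat.
have n1 : 1 <= n by rewrite ler1n (leq_trans C0).
pose y := Num.sqrt (n / K); pose m := Num.truncn y.
have y2 : y ^+ 2 = n / K by rewrite sqr_sqrtr // divr_ge0 //; lra.
have y1 : 1 <= y by rewrite sqrtr_ge1 // ler_pdivlMr ?mul1r.
have /andP[my ym] : m%:R <= y < m.+1%:R by apply: truncn_itv; lra.
have [|Q QP crQ] := hC P m gP.
  rewrite -(ler_nat R) 2!natrM -/n -/K mulrC -ler_pdivlMr // -y2 expr2.
  by rewrite ler_pM.
exists Q; split=> //; apply: (@le_trans _ _ (m%:R : R)); last by rewrite ler_nat.
have m1 : 1 <= m%:R :> R by rewrite ler1n lt0n; apply: contraTneq ym => ->; rewrite -leNgt.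
rewrite -natr1 in ym.
have sn : Num.sqrt n = Num.sqrt K * y.
  by rewrite -sqrtrM 1?ltW // mulrC divfK ?gt_eqF.
rewrite /log2 expr_div_n.
have -> : ln 2 ^+ 2 / (32 * Num.sqrt K) * (ln n ^+ 2 / ln 2 ^+ 2) = ln n ^+ 2 / (32 * Num.sqrt K).
  by field; rewrite !gt_eqF.
rewrite ler_pdivrMr ?mulr_gt0 //; apply: le_trans (ln_sqr_le n1) _.
rewrite sn; have : Num.sqrt K * y <= Num.sqrt K * (2 * m%:R) by rewrite ler_pM2l //; lra.
lra.
Qed.
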